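(* Let $K\to K'$ be an algebraically pure morphism of fields and $x=(x_1,\ldots,x_n)$. Let $J_1,\ldots,J_p$ be subsets of $\{1,\ldots,n\}$, $x_{J_i}=(x_k)_{k\in J_i}$, and let $A_i=K\langle x_{J_i}\rangle$, resp. $A'_i=K'\langle x_{J_i}\rangle$, be the rings of algebraic power series in $x_{J_i}$ over $K$, resp. $K'$. Set $\mathcal{N}=A_1\times\cdots\times A_p$ and $\mathcal{N}'=A'_1\times\cdots\times A'_p$. Let $f$ be a finite system of polynomials in $K\langle x\rangle[Y]$, $Y=(Y_1,\ldots,Y_p)$, and let $\hat y\in\mathcal{N}'$ satisfy $f(\hat y)=0$ (in $K'\langle x\rangle$). Then there exists $y\in\mathcal{N}$ such that $f(y)=0$ and $\operatorname{ord} y_i=\operatorname{ord}\hat y_i$ for all $i\in\{1,\ldots,p\}$.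
   Context: A ring morphism $A\to B$ is called algebraically pure if every finite system of polynomial equations over $A$ which has a solution in $B$ also has a solution in $A$. For a field $K$ and variables $z=(z_1,\ldots,z_m)$, $K\langle z\rangle$ denotes the ring of algebraic power series, i.e. the set of formal power series in $K[[z]]$ that are algebraic over the polynomial ring $K[z]$. For a power series $g$, $\operatorname{ord} g$ is the least total degree of a monomial appearing in $g$ with nonzero coefficient ($\operatorname{ord}0=\infty$). *)

(* Defs.v *)
From HB Require Import structures.
From mathcomp Require Import all_boot all_order all_algebra.
From mathcomp Require Import mpoly.
From Stdlib Require Import ClassicalDescription.

Set Implicit Arguments.
Unset Strict Implicit.
Unset Printing Implicit Defensive.

Import Order.TTheory GRing.Theory.
Local Open Scope ring_scope.

Definition series (R : Type) (n : nat) := 'X_{1..n} -> R.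

Section Series.
Variables (R : nzRingType) (n : nat).

Definition ps_zero : series R n := fun _ => 0.
Definition ps_one : series R n := fun m => (m == 0%MM)%:R.
Definition ps_add (f g : series R n) : series R n := fun m => f m + g m.
Definition ps_mul (f g : series R n) : series R n := fun m =>
  \sum_(ab : 'X_{1..n < (mdeg m).+1, (mdeg m).+1} | m == (ab.1 + ab.2)%MM)
     f ab.1 * g ab.2.
Definition ps_exp (f : series R n) (k : nat) : series R n :=
  iter k (ps_mul f) ps_one.
Definition ps_of_mpoly (p : {mpoly R[n]}) : series R n := fun m => p@_m.

Definition ps_eval_poly (P : {poly {mpoly R[n]}}) (f : series R n)
  : series R n := fun m =>
  \sum_(i < size P) ps_mul (ps_of_mpoly P`_i) (ps_exp f i) m.

Definition algebraic_series (f : series R n) : Prop :=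
  exists P : {poly {mpoly R[n]}}, P != 0 /\ ps_eval_poly P f = ps_zero.

(* ord f : least total degree of a monomial with nonzero coefficient;
   None stands for ord 0 = infinity. *)
Definition ord_pred (f : series R n) : pred nat := fun d =>
  if excluded_middle_informative (exists m : 'X_{1..n}, mdeg m = d /\ f m <> 0)
  then true else false.

Lemma ord_pred_ex (f : series R n) :
  (exists m : 'X_{1..n}, f m <> 0) -> exists d, ord_pred f d.
Proof.
move=> [m Hm]; exists (mdeg m); rewrite /ord_pred.
by case: excluded_middle_informative => // [[]]; exists m.
Qed.

Definition ps_ord (f : series R n) : option nat :=
  match excluded_middle_informative (exists m : 'X_{1..n}, f m <> 0) with
  | left H => Some (ex_minn (ord_pred_ex H))
  | right _ => None
  end.

End Series.

(* Embedding of series in the variables x_J (J a subset of {1..n}, variables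
   of x_J numbered by the increasing enumeration of J) into series in x. *)
Definition ps_embed (R : nzRingType) (n : nat) (J : {set 'I_n})
  (g : series R #|J|) : series R n := fun m =>
  if [forall i, (i \notin J) ==> (m i == 0%N)]
  then g [multinom m (@enum_val _ (mem J) j) | j < #|J| ]
  else 0.

Definition ps_map (R S : Type) (n : nat) (phi : R -> S) (f : series R n)
  : series S n := fun m => phi (f m).

(* Polynomials in Y = (Y_1,...,Y_p) with coefficients in series in x,
   given as a finite list of terms (c, a) standing for c * Y^a. *)
Definition spoly (R : Type) (n p : nat) := seq (series R n * 'X_{1..p}).

Definition spoly_map (R S : Type) (n p : nat) (phi : R -> S)
  (F : spoly R n p) : spoly S n p :=
  map (fun t => (ps_map phi t.1, t.2)) F.

Definition ps_monom (R : nzRingType) (n p : nat) (y : 'I_p -> series R n)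
  (a : 'X_{1..p}) : series R n :=
  \big[@ps_mul R n / @ps_one R n]_(i < p) ps_exp (y i) (a i).

Definition spoly_eval (R : nzRingType) (n p : nat) (F : spoly R n p)
  (y : 'I_p -> series R n) : series R n := fun m =>
  \sum_(t <- F) ps_mul t.1 (ps_monom y t.2) m.

Definition spoly_over_alg (R : nzRingType) (n p : nat) (F : spoly R n p) : Prop :=
  forall t, List.In t F -> algebraic_series t.1.

Definition alg_pure (A B : comRingType) (phi : {rmorphism A -> B}) : Prop :=
  forall (N : nat) (s : seq {mpoly A[N]}),
    (exists v : 'I_N -> B, forall q, q \in s -> (map_mpoly phi q).@[v] = 0) ->
    exists v : 'I_N -> A, forall q, q \in s -> q.@[v] = 0.

(* Main.v *)
Require Import Defs.
From HB Require Import structures.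
From mathcomp Require Import all_boot all_order all_algebra.
From mathcomp Require Import mpoly.
From mathcomp Require Import zify.
From Stdlib Require Import Classical ClassicalEpsilon FunctionalExtensionality.

(** The coefficients of an algebraic power series lie in a finitely generated
    ring, so all the [yhat i] have coefficients in one ring [K[v] = K[v_1, ...,
    v_N]] inside [K'].  By Hilbert's basis theorem the ideal of relations
    between the [v_k] is generated by a finite system of equations, which by
    purity has a solution [t] in [K]; this gives a [K]-algebra morphism
    [K[v] -> K], applied coefficientwise to [yhat].  It preserves [f(y) = 0], and
    it preserves the orders as soon as the inverse of a lowest coefficient of
    each [yhat i] is among the [v_k]. *)

Set Implicit Arguments.
Unset Strict Implicit.
Unset Printing Implicit Defensive.

Import Order.TTheory GRing.Theory.
Local Open Scope ring_scope.

(** * Truncation of power series to polynomials *)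

Section Truncation.
Variables (R : nzRingType) (n : nat).
Implicit Types (f g : series R n) (p q : {mpoly R[n]}) (m : 'X_{1..n}).

(** Coefficients of degree at most [d] of a product depend only on such coefficients of the factors,
    so series identities can be checked on polynomials. *)
Definition approx d f p := forall m, (mdeg m <= d)%N -> f m = p@_m.

Definition trunc d f : {mpoly R[n]} := \sum_(m : 'X_{1..n < d.+1}) f m *: 'X_[m].

Lemma approx_trunc d f : approx d f (trunc d f).
Proof. by move=> m dm; rewrite /trunc mcoeff_mpoly. Qed.

Lemma approx_one d : approx d (@ps_one R n) 1.
Proof. by move=> m _; rewrite mcoeff1. Qed.

Lemma approx_mul d f g p q :
  approx d f p -> approx d g q -> approx d (ps_mul f g) (p * q).
Proof.
move=> fp gq m dm; rewrite mcoeffM; apply: eq_bigr => -[a b] /= /eqP mab.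
have dab : (mdeg a + mdeg b <= d)%N by rewrite -mdegD -mab.
by rewrite fp ?gq //; apply: leq_trans dab; rewrite ?leq_addr ?leq_addl.
Qed.

Lemma approx_exp d f p k : approx d f p -> approx d (ps_exp f k) (p ^+ k).
Proof.
move=> fp; elim: k => [|k IH]; first exact: approx_one.
by rewrite exprS; apply: approx_mul.
Qed.

Lemma approx_eval_poly d (P : {poly {mpoly R[n]}}) f p :
  approx d f p -> approx d (ps_eval_poly P f) P.[p].
Proof.
move=> fp m dm; rewrite horner_coef raddf_sum; apply: eq_bigr => i _ /=.
by apply: (@approx_mul d) => //; apply: approx_exp.
Qed.

Lemma eval_poly_zeroP (P : {poly {mpoly R[n]}}) f :
  ps_eval_poly P f = @ps_zero R n <->
  forall d m, (mdeg m <= d)%N -> P.[trunc d f]@_m = 0.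
Proof.
split=> [Pf d m dm|Pf].
  by rewrite -(approx_eval_poly _ (@approx_trunc d f) dm) Pf.
apply: functional_extensionality => m.
by rewrite (approx_eval_poly _ (@approx_trunc (mdeg m) f)) ?Pf.
Qed.

End Truncation.

(** * Coefficientwise application of a ring morphism *)

Section Naturality.
Variables (R S : nzRingType) (psi : {rmorphism R -> S}) (n : nat).
Implicit Types (f g : series R n).

Local Notation psm := (@ps_map R S _ psi).

Lemma ps_map_one : psm (@ps_one R n) = @ps_one S n.
Proof. by apply: functional_extensionality => m; rewrite /ps_map rmorph_nat. Qed.

Lemma ps_map_mul f g : psm (ps_mul f g) = ps_mul (psm f) (psm g).
Proof.
apply: functional_extensionality => m; rewrite /ps_map rmorph_sum.
by apply: eq_bigr => i _; rewrite rmorphM.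
Qed.

Lemma ps_map_exp f k : psm (ps_exp f k) = ps_exp (psm f) k.
Proof. by elim: k => [|k IH]; [exact: ps_map_one | rewrite /= ps_map_mul IH]. Qed.

Lemma ps_map_embed (J : {set 'I_n}) (f : series R #|J|) :
  psm (ps_embed f) = ps_embed (psm f).
Proof.
apply: functional_extensionality => m; rewrite /ps_map /ps_embed.
by case: ifP => // _; rewrite rmorph0.
Qed.

Lemma ps_map_monom p (y : 'I_p -> series R n) a :
  psm (ps_monom y a) = ps_monom (fun i => psm (y i)) a.
Proof.
rewrite /ps_monom (big_morph psm ps_map_mul ps_map_one).
by apply: eq_bigr => i _; rewrite ps_map_exp.
Qed.

Lemma ps_map_spoly_eval p (F : spoly R n p) (y : 'I_p -> series R n) :
  psm (spoly_eval F y) = spoly_eval (spoly_map psi F) (fun i => psm (y i)).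
Proof.
apply: functional_extensionality => m.
rewrite /ps_map /spoly_eval rmorph_sum big_map.
apply: eq_bigr => t _ /=.
by rewrite -ps_map_monom -ps_map_mul.
Qed.

Lemma ps_map_eval_poly (P : {poly {mpoly R[n]}}) f :
  psm (ps_eval_poly P f) = ps_eval_poly (map_poly (map_mpoly psi) P) (psm f).
Proof.
apply: functional_extensionality => m.
have fm : approx (mdeg m) (psm f) (map_mpoly psi (trunc (mdeg m) f)).
  by move=> k dk; rewrite mcoeff_map_mpoly -approx_trunc.
rewrite (approx_eval_poly _ fm) // horner_map mcoeff_map_mpoly /ps_map.
by rewrite (approx_eval_poly _ (@approx_trunc _ _ (mdeg m) f)).
Qed.

End Naturality.

(** * Relations between p-th powers *)

(** A matrix [B] is enlarged inside [W] until its row space is all of [W]. As [W] is proper, the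
    cokernel of [B] has a nonzero column, which kills [W]. *)
Lemma subspace_annihilator (F : fieldType) r (W : 'rV[F]_r -> Prop) :
  W 0 -> (forall a u v, W u -> W v -> W (a *: u + v)) -> (exists u, ~ W u) ->
  exists2 d : 'cV[F]_r, d != 0 & forall u, W u -> u *m d = 0.
Proof.
move=> W0 WL [u0 Wu0].
have [B [BW WB]] : exists B : 'M[F]_r,
    (forall u : 'rV_r, (u <= B)%MS -> W u) /\ (forall u, W u -> (u <= B)%MS).
  suff grow k (A : 'M[F]_r) : (r - \rank A <= k)%N ->
      (forall u : 'rV_r, (u <= A)%MS -> W u) ->
      exists B : 'M[F]_r,
        (forall u : 'rV_r, (u <= B)%MS -> W u) /\ (forall u, W u -> (u <= B)%MS).
    by apply: (grow _ 0 (leqnn _)) => u; rewrite submx0 => /eqP ->.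
  elim: k A => [|k IH] A rkA AW.
    exists A; split=> // u _; apply: submx_full.
    by rewrite /row_full eqn_leq rank_leq_col -subn_eq0 -leqn0.
  have [WA|nWA] := classic (forall u, W u -> (u <= A)%MS); first by exists A.
  have [u nWu] := not_all_ex_not _ _ nWA.
  have [Wu uA] := imply_to_and _ _ nWu.
  apply: (IH (A + u)%MS) => [|x /sub_addsmxP [[y z] /= ->]].
    have : (\rank A < \rank (A + u)%MS)%N.
      rewrite ltn_neqAle mxrankS ?addsmxSl // andbT.
      rewrite (mxrank_leqif_sup (addsmxSl A u)) addsmx_sub submx_refl.
      by apply/negP.
    by lia.
  rewrite addrC [z]mx11_scalar mul_scalar_mx.
  by apply: WL => //; apply: AW; apply: submxMl.
have nz : u0 *m cokermx B != 0.
  by apply/negP => /eqP u0B; apply: Wu0; apply: BW; rewrite submxE u0B.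
have [j nzj] : exists j, (u0 *m cokermx B) 0 j != 0.
  apply: not_all_not_ex => all0; move/eqP: nz; apply; apply/rowP => j.
  by rewrite [RHS]mxE; apply/eqP/negPn/negP.
exists (col j (cokermx B)) => [|u /WB uB].
  have ej : (u0 *m col j (cokermx B)) 0 0 = (u0 *m cokermx B) 0 j.
    by rewrite colE mulmxA -colE mxE.
  by apply: contra nzj => /eqP cj0; rewrite -ej cj0 mulmx0 mxE.
by move: uB; rewrite submxE colE mulmxA => /eqP ->; rewrite mul0mx.
Qed.

(* By additivity of Frobenius, the vectors [w] with
   [\sum_i c i * w i ^+ p = 0] form a proper subspace, which lies in a
   hyperplane. *)
Lemma pchar_linear_relation (F : fieldType) p (I : finType) (T : Type)
    (c : I -> F) (w : T -> I -> F) :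
  p \in [char F] -> (exists i, c i != 0) ->
  (forall t, \sum_i c i * w t i ^+ p = 0) ->
  exists2 d : I -> F, (exists i, d i != 0) & forall t, \sum_i d i * w t i = 0.
Proof.
move=> pF [i0 ci0] cw.
have pgt0 : (0 < p)%N by apply: prime_gt0; apply: pcharf_prime pF.
pose W (u : 'rV[F]_#|I|) := \sum_i c i * u 0 (enum_rank i) ^+ p = 0.
have [|a u v Wu Wv||d nzd dW] := @subspace_annihilator F #|I| W.
- by apply: big1 => i _; rewrite mxE expr0n gtn_eqF ?mulr0.
- rewrite /W (eq_bigr (fun i => a ^+ p * (c i * u 0 (enum_rank i) ^+ p) +
     c i * v 0 (enum_rank i) ^+ p)) => [|i _].
    by rewrite big_split -mulr_sumr /= Wu Wv mulr0 addr0.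
  rewrite !mxE -[X in _ * X](pFrobenius_autE pF) rmorphD rmorphM /=.
  by rewrite !pFrobenius_autE mulrDr mulrCA.
- exists (delta_mx 0 (enum_rank i0)); rewrite /W (bigD1 i0) //= big1 => [|i ii0].
    by rewrite addr0 mxE !eqxx expr1n mulr1; apply/eqP.
  by rewrite mxE (inj_eq enum_rank_inj) (negPf ii0) andbF expr0n gtn_eqF ?mulr0.
exists (fun i => d (enum_rank i) 0) => [|t].
  apply: not_all_not_ex => all0; move/eqP: nzd; apply; apply/colP => j.
  by rewrite [RHS]mxE -[j]enum_valK; apply/eqP/negPn/negP.
pose u : 'rV[F]_#|I| := \row_j w t (enum_val j).
have /dW : W u by rewrite /W -[RHS](cw t); apply: eq_bigr => i _; rewrite mxE enum_rankK.
move/(congr1 (fun M : 'M_1 => M 0 0)); rewrite mxE [in RHS]mxE => ud0.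
apply: etrans ud0; rewrite (reindex _ (onW_bij _ (enum_val_bij I))) /=; apply: eq_bigr => j _.
by rewrite mxE enum_valK mulrC.
Qed.

(** * Multiplication by a [p]-th power in characteristic [p] *)

Section MCoeff.
Variables (R : comNzRingType) (n : nat).
Implicit Types (u v : {mpoly R[n]}) (m k : 'X_{1..n}).

Lemma mcoeff_mpolyXM k u m :
  ('X_[k] * u)@_m = if (k <= m)%MM then u@_(m - k)%MM else 0.
Proof.
case: ifP => [km|km]; first by rewrite mulrC -{1}(submK km) addmC mcoeffMX.
rewrite mcoeffM big1 // => -[a b] /= /eqP mab.
rewrite mcoeffX; case: eqP => [ka|_]; last by rewrite mul0r.
by have := lem_addr a b; rewrite -mab -ka km.
Qed.

Variables (p : nat) (pR : p \in [char R]).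

Let pM : p \in [char {mpoly R[n]}] := rmorph_pchar (@mpolyC n R) pR.
Let pgt0 : (0 < p)%N. Proof. by apply: prime_gt0; apply: pcharf_prime pR. Qed.

Lemma mpoly_exp_pchar u :
  u ^+ p = \sum_(m <- msupp u) (u@_m) ^+ p *: 'X_[m *+ p].
Proof.
rewrite {1}(mpolyE u) -(pFrobenius_autE pM) rmorph_sum; apply: eq_bigr => m _ /=.
by rewrite pFrobenius_autE exprZn mpolyXn.
Qed.

Lemma mulmI : injective (fun m : 'X_{1..n} => m *+ p)%MM.
Proof.
move=> m k /mnmP mk; apply/mnmP => i; have := mk i; rewrite !mulmnE => /eqP.
by rewrite eqn_pmul2r // => /eqP.
Qed.

Lemma mcoeff_exp_pchar u m : (u ^+ p)@_(m *+ p) = (u@_m) ^+ p.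
Proof.
rewrite mpoly_exp_pchar raddf_sum /=.
have neq_m k : k != m -> ((u@_k) ^+ p *: 'X_[k *+ p])@_(m *+ p) = 0.
  by move=> km; rewrite mcoeffZ mcoeffX (inj_eq mulmI) (negPf km) mulr0.
have [um|um] := boolP (m \in msupp u).
  rewrite (bigD1_seq m um (msupp_uniq u)) big1 //=.
  by rewrite addr0 mcoeffZ mcoeffX eqxx mulr1.
rewrite (memN_msupp_eq0 um) expr0n gtn_eqF // big_seq big1 // => k uk.
by apply: neq_m; apply: contraNneq um => <-.
Qed.

Lemma mcoeff_exp_pchar_neq u k :
  (forall m, k <> (m *+ p)%MM) -> (u ^+ p)@_k = 0.
Proof.
move=> kp; rewrite mpoly_exp_pchar raddf_sum big1 // => m _ /=.
by rewrite mcoeffZ mcoeffX; case: eqP => [/esym/kp//|_]; rewrite mulr0.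
Qed.

(** All exponents of [u ^+ p] are divisible by [p], so only the monomials of [v] congruent to [be]
    modulo [p] contribute. *)
Lemma mcoeff_mul_exp_pchar b v u (be mu : 'X_{1..n}) :
  (msize v <= b)%N -> (forall i, be i < p)%N ->
  (v * u ^+ p)@_(be + mu *+ p)%MM =
  \sum_(ga : 'X_{1..n < b}) v@_(be + ga *+ p)%MM *
    (if (ga <= mu)%MM then u@_(mu - ga)%MM else 0) ^+ p.
Proof.
move=> vb bep.
have term (al : 'X_{1..n < b}) : ('X_[al] * u ^+ p)@_(be + mu *+ p)%MM =
    \sum_(ga : 'X_{1..n < b}) ((al : 'X_{1..n}) == be + ga *+ p)%MM%:R *
    (if (ga <= mu)%MM then u@_(mu - ga)%MM else 0) ^+ p.
  have [[ga Ega]|noga] := classic (exists ga, (al : 'X_{1..n}) = be + ga *+ p)%MM.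
    have gab : (mdeg ga < b)%N.
      have := bmdeg al; rewrite Ega mdegD mdegMn; nia.
    rewrite (bigD1 (BMultinom gab)) //= big1 => [|k].
      rewrite Ega eqxx mul1r addr0 mcoeff_mpolyXM.
      have -> : (be + ga *+ p <= be + mu *+ p)%MM = (ga <= mu)%MM.
        apply/mnm_lepP/mnm_lepP => h i; have := h i;
          rewrite !mnmDE !mulmnE leq_add2l leq_pmul2r //.
      case: ifP => [gamu|_]; last by rewrite expr0n gtn_eqF.
      rewrite -mcoeff_exp_pchar; congr (_ @_ _); apply/mnmP => i.
      by rewrite !(mnmDE, mnmBE, mulmnE); nia.
    move=> kga; case: eqP => [e|_]; last by rewrite mul0r.
    case/eqP: kga; apply/val_inj/mulmI => /=.
    by apply: (@addmI _ be); rewrite -e Ega.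
  rewrite [RHS]big1 => [|k _]; last first.
    by case: eqP => [e|_]; [case: noga; exists k | rewrite mul0r].
  rewrite mcoeff_mpolyXM; case: ifP => // /mnm_lepP le.
  apply: mcoeff_exp_pchar_neq => nu /mnmP Enu.
  apply: noga; exists (mu - nu)%MM; apply/mnmP => i.
  have := Enu i; have := le i; have := bep i.
  rewrite !(mnmDE, mnmBE, mulmnE) => ? ? E.
  (* By [be i < p]. So [mu - nu] is a genuine difference and [al] has the excluded form. *)
  have : (nu i <= mu i)%N by rewrite leqNgt; apply/negP => ?; nia.
  by nia.
rewrite {1}(mpolywE vb) mulr_suml raddf_sum /=.
under eq_bigr => al _ do rewrite -scalerAl mcoeffZ term mulr_sumr.
rewrite exchange_big; apply: eq_bigr => ga _ /=.
rewrite [v in v@_(be + _)%MM](mpolywE vb) raddf_sum mulr_suml /=; apply: eq_bigr => al _.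
by rewrite mcoeffZ mcoeffX mulrA.
Qed.

End MCoeff.

(** * Separability of algebraic power series *)

Section Separability.
Variables (F : fieldType) (n : nat) (f : series F n).
Implicit Types (P : {poly {mpoly F[n]}}).

(* When [P' = 0], [P(f) = 0] reads [\sum_j P_(j p) (f ^ j) ^ p = 0]; extracting
   the monomials congruent to [be] modulo [p] leaves a relation between [p]-th
   powers of the coefficients of the [f ^ j]. *)
Lemma annihilator_descent P :
  P != 0 -> ps_eval_poly P f = @ps_zero F n -> P^`() = 0 ->
  exists R : {poly {mpoly F[n]}},
    [/\ R != 0, ps_eval_poly R f = @ps_zero F n & (size R < size P)%N].
Proof.
move=> nzP /eval_poly_zeroP Pf dP.
have sP : (1 < size P)%N.
  rewrite ltnNge; apply/negP => /size1_polyC EP; case/eqP: nzP.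
  rewrite EP; suff -> : P`_0 = 0 by [].
  apply/mpolyP => m; have := Pf _ m (leqnn _).
  by rewrite EP hornerC coefC eqxx mcoeff0.
have coefP i : P`_i *+ i = 0.
  case: i => [|i]; first by rewrite mulr0n.
  by rewrite -coef_deriv dP coef0.
(* The degree of [P] kills its nonzero leading coefficient, hence is zero in [F]. *)
have [p pF] : exists p, p \in [char F].
  apply: (@natf0_pchar _ (size P).-1); first by lia.
  have := coefP (size P).-1; rewrite -lead_coefE -(mulr_natl (lead_coef P)) => /eqP.
  rewrite mulf_eq0 lead_coef_eq0 (negPf nzP) orbF => /eqP/(congr1 (mcoeff 0%MM)).
  by rewrite -(rmorph_nat (@mpolyC n F)) mcoeffC eqxx mulr1 mcoeff0 => ->.
have pP := pcharf_prime pF; have pgt1 := prime_gt1 pP.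
have coefP0 i : ~~ (p %| i)%N -> P`_i = 0.
  move=> npi; apply/eqP; have /eqP := coefP i; rewrite -(mulr_natr P`_i) mulf_eq0.
  case/orP => // /eqP/(congr1 (mcoeff 0%MM)).
  rewrite -(rmorph_nat (@mpolyC n F)) mcoeffC eqxx mulr1 mcoeff0 => /eqP.
  by rewrite -(dvdn_pcharf pF) (negPf npi).
(* As [p >= 2] and [N >= 1], [N] coefficients suffice for [Q]. The new annihilator also has size at
   most [N], whence the strict decrease. *)
set N := (size P).-1.
pose Q := \poly_(j < N) P`_(j * p).
have PQ : P = Q \Po 'X^p.
  apply/polyP => i; rewrite coef_comp_poly_Xn ?coef_poly; last by lia.
  case: ifP => [/dvdnP [j ->]|/negbT /coefP0 //].
  rewrite mulnK; last by lia.
  case: ltnP => // Nj; apply: nth_default; have := leq_mul Nj pgt1.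
  by apply: leq_trans; rewrite -[X in (X <= _)%N]/(size P) /N; lia.
pose b := (\max_(i < size P) msize P`_i)%N.
have Pb i : (msize P`_i <= b)%N.
  have [iP|Pi] := ltnP i (size P); first exact: (leq_bigmax (Ordinal iP)).
  by rewrite nth_default // msize0.
(* A monomial [al] actually occurring in [P] selects the residue class [be], so that the relation
   extracted is nontrivial. *)
have [i nzPi [al nzal]] : exists2 i, P`_i != 0 & exists al, (P`_i)@_al != 0.
  exists (size P).-1; rewrite -?lead_coefE ?lead_coef_eq0 //.
  by exists (mlead (lead_coef P)); rewrite mleadc_eq0 lead_coef_eq0.
have [j Ei] : exists j, i = (j * p)%N.
  by apply/dvdnP; apply: contraNT nzPi => /coefP0 ->.
have jN : (j < N)%N.
  have : (i < size P)%N by rewrite ltnNge; apply: contra nzPi => ?; rewrite nth_default.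
  by rewrite /N Ei; nia.
pose be := [multinom (al k %% p)%N | k < n].
pose ga0 := [multinom (al k %/ p)%N | k < n].
have Eal : al = (be + ga0 *+ p)%MM.
  by apply/mnmP => k; rewrite mnmDE mulmnE !mnmE addnC -divn_eq.
have ga0b : (mdeg ga0 < b)%N.
  have : (mdeg al < msize P`_i)%N by apply: msize_mdeg_lt; rewrite mcoeff_msupp.
  have := Pb i; rewrite Eal mdegD mdegMn; nia.
have bep k : (be k < p)%N by rewrite mnmE ltn_mod; lia.
pose c (t : 'I_N * 'X_{1..n < b}) := (P`_(t.1 * p))@_(be + t.2 *+ p)%MM.
(* This is the coefficient of [x^mu] in [x^ga f^j] for [t = (j, ga)]; a linear relation valid for
   all [mu] is thus a polynomial killing [f]. *)
pose w mu (t : 'I_N * 'X_{1..n < b}) :=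
  if (t.2 <= mu)%MM then ps_exp f t.1 (mu - t.2)%MM else 0.
have [||d [[j1 ga1] nzd] dw] := pchar_linear_relation (c := c) (w := w) pF.
- by exists (Ordinal jN, BMultinom ga0b); rewrite /c /= -Ei -Eal.
- move=> mu; set m := (be + mu *+ p)%MM.
  rewrite -[RHS](Pf _ m (leqnn _)) PQ horner_comp hornerXn.
  rewrite (@horner_coef_wide _ N) ?size_poly // raddf_sum.
  rewrite -(pair_bigA _ (fun (j : 'I_N) (ga : 'X_{1..n < b}) => (P`_(j * p))@_(be + ga *+ p)%MM *
    (if (ga <= mu)%MM then ps_exp f j (mu - ga)%MM else 0) ^+ p)) /=; apply: eq_bigr => k _ /=.
  rewrite coef_poly ltn_ord exprAC (mcoeff_mul_exp_pchar pF _ _ (Pb _)) //.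
  apply: eq_bigr => ga _; congr (_ * _ ^+ p); rewrite /w /=.
  case: ifP => // _; apply: approx_exp (@approx_trunc _ _ _ _) _ _.
  rewrite (leq_trans (mdegB _ _)) // /m mdegD mdegMn; nia.
pose R := \poly_(j < N)
  (if insub j is Some j' then \sum_ga d (j', ga) *: 'X_[ga] else 0) : {poly {mpoly F[n]}}.
have RE (k : 'I_N) : R`_k = \sum_ga d (k, ga) *: 'X_[ga].
  by rewrite coef_poly ltn_ord valK.
exists R; split.
- apply: contra nzd => /eqP R0; have := RE j1; rewrite R0 coef0.
  move/(congr1 (mcoeff ga1)); rewrite mcoeff0 raddf_sum (bigD1 ga1) //= big1 => [|g gg1].
    by rewrite addr0 mcoeffZ mcoeffX eqxx mulr1 => ->.
  by rewrite mcoeffZ mcoeffX -bmeqP (negPf gg1) mulr0.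
- apply: functional_extensionality => mu.
  rewrite (approx_eval_poly _ (@approx_trunc _ _ (mdeg mu) f)) //.
  rewrite (@horner_coef_wide _ N) ?size_poly // raddf_sum -[RHS](dw mu).
  rewrite [RHS](eq_bigr (fun t => d (t.1, t.2) * w mu (t.1, t.2))) => [|[]//].
  rewrite -(pair_bigA _ (fun (j : 'I_N) (ga : 'X_{1..n < b}) =>
    d (j, ga) * w mu (j, ga))); apply: eq_bigr => k _ /=.
  rewrite RE mulr_suml raddf_sum; apply: eq_bigr => ga _ /=.
  rewrite -scalerAl mcoeffZ mcoeff_mpolyXM /w /=; case: ifP => // _.
  by rewrite (approx_exp _ (@approx_trunc _ _ (mdeg mu) f)) // mdegB.
- by rewrite (leq_ltn_trans (size_poly _ _)) // /N; lia.
Qed.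

(** Induction on the size of an annihilator: if its derivative kills [f] too, a smaller annihilator
    is that derivative or, when the derivative is zero, the result of the descent. *)
Lemma algebraic_separable :
  algebraic_series f ->
  exists P, ps_eval_poly P f = @ps_zero F n /\ ps_eval_poly P^`() f <> @ps_zero F n.
Proof.
case=> P0 [nzP0 P0f].
suff descent k P : (size P <= k)%N -> P != 0 -> ps_eval_poly P f = @ps_zero F n ->
    exists P, ps_eval_poly P f = @ps_zero F n /\ ps_eval_poly P^`() f <> @ps_zero F n.
  exact: (descent _ P0 (leqnn _)).
elim: k P => [|k IH] P sP nzP Pf.
  by case/eqP: nzP; apply/eqP; rewrite -size_poly_leq0.
have [dPf|ndPf] := classic (ps_eval_poly P^`() f = @ps_zero F n); last by exists P.
have [dP|nzdP] := eqVneq P^`() 0.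
  have [R [nzR Rf sR]] := annihilator_descent nzP Pf dP.
  by apply: (IH R) => //; lia.
apply: (IH P^`()) => //.
by have := lt_size_deriv nzP; lia.
Qed.

End Separability.

(** * Finite generation of the coefficients *)

(** The remainder is built from Hasse derivatives, which avoids dividing by factorials. *)
Lemma horner_taylor2 (R : comNzRingType) (P : {poly R}) (x y : R) :
  exists r, P.[x + y] = P.[x] + P^`().[x] * y + y ^+ 2 * r.
Proof.
exists (\sum_(i < size P) P^`N(i.+2).[x] * y ^+ i).
rewrite (@nderiv_taylor_wide _ (size P).+2) //; [|exact: mulrC|by lia].
rewrite 2!big_ord_recl /= nderivn0 poly.nderivn1 expr0 mulr1 expr1 addrA mulr_sumr.
congr (_ + _); apply: eq_bigr => i _.
by rewrite -[LHS]/(P^`N(i.+2).[x] * y ^+ (2 + i)) exprD mulrCA.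
Qed.

Section LowMonomials.
Variables (R : nzRingType) (n : nat).
Implicit Types (u v : {mpoly R[n]}) (a b : 'X_{1..n}).

(** The monomial order is total, compares degrees first and respects addition, so lowest terms
    multiply as in one variable. *)
Definition supp_ge a u := forall k, (k < a)%O -> u@_k = 0.

Lemma mcoeffM_supp_ge a b u v :
  supp_ge a u -> supp_ge b v -> (u * v)@_(a + b)%MM = u@_a * v@_b.
Proof.
move=> ua vb; rewrite mcoeffM.
have da : (mdeg a < (mdeg (a + b)).+1)%N by rewrite ltnS mdegD leq_addr.
have db : (mdeg b < (mdeg (a + b)).+1)%N by rewrite ltnS mdegD leq_addl.
rewrite (bigD1 (BMultinom da, BMultinom db)) //= big1 ?addr0 // => -[k l] /=.
case/andP=> /eqP abkl neq.
have [ka|ak|ka] := ltgtP (k : 'X_{1..n}) a; first by rewrite ua ?mul0r.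
  have [lb|bl] := ltP (l : 'X_{1..n}) b; first by rewrite vb ?mulr0.
  by have := ltmc_le_add ak bl; rewrite -abkl ltxx.
case/negP: neq; rewrite xpair_eqE !bmeqP /= ka eqxx /=.
by apply/eqP/(@addmI _ a); rewrite -{1}ka -abkl.
Qed.

Lemma supp_geM a b u v :
  supp_ge a u -> supp_ge b v -> supp_ge (a + b)%MM (u * v).
Proof.
move=> ua vb m mab; rewrite mcoeffM big1 // => -[k l] /= /eqP mkl.
have [ka|ak] := ltP (k : 'X_{1..n}) a; first by rewrite ua ?mul0r.
have [lb|bl] := ltP (l : 'X_{1..n}) b; first by rewrite vb ?mulr0.
by have := lem_add ak bl; rewrite -mkl leNgt mab.
Qed.

End LowMonomials.

(** The monomial order is well founded. As it compares degrees first, [mdeg m0] is also the order of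
    [f]. *)
Lemma exists_lowest_monomial (R : nzRingType) n (f : series R n) :
  f <> @ps_zero R n -> exists m0, f m0 != 0 /\ forall k, (k < m0)%O -> f k = 0.
Proof.
move=> nzf; have [m1 nzfm1] : exists m, f m != 0.
  apply: not_all_not_ex => all0; apply: nzf; apply: functional_extensionality => m.
  by apply/eqP/negPn/negP.
elim/(@ltmwf n): m1 nzfm1 => m1 IH nzf1.
have [[k /andP[km1 fk]]|none] := classic (exists k, (k < m1)%O && (f k != 0)).
  exact: IH fk.
exists m1; split=> // k km1; apply/eqP/negPn/negP => fk.
by apply: none; exists k; rewrite km1.
Qed.

(* A several-variable Eisenstein theorem.  If [P(f) = 0] and [c x^m0] is the
   lowest term of [P'(f)], Taylor's formula at a truncation [g] of [f] before a
   large monomial [m] gives [P(g)_(m0 + m) = - c * f_m], so each coefficient of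
   [f] comes from earlier ones by ring operations and the division by [c]. *)
Lemma algebraic_coef_fg (F : fieldType) n (f : series F n) :
  algebraic_series f ->
  exists s : seq F, forall D : subringClosed F,
    (forall x, x \in s -> x \in D) -> forall m, f m \in D.
Proof.
move=> /algebraic_separable [P [/eval_poly_zeroP Pf dPf]].
pose Q := ps_eval_poly P^`() f.
have [m0 [nzQ Qlo]] := exists_lowest_monomial dPf; rewrite -/Q in nzQ Qlo.
(* The coefficients of [f] up to the degree of [m0] start the recursion, whose step requires
   [m0 < m]. *)
exists ((Q m0)^-1 :: [seq f (bmnm k) | k : 'X_{1..n < (mdeg m0).+1}] ++
  flatten [seq [seq P`_i@_k | k <- msupp P`_i] | i <- iota 0 (size P)]).
move=> D sD.
have cD : (Q m0)^-1 \in D by apply: sD; rewrite inE eqxx.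
have lowD m : (mdeg m <= mdeg m0)%N -> f m \in D.
  move=> dm; apply: sD; rewrite inE mem_cat; apply/orP; right; apply/orP; left.
  by apply/mapP; exists (BMultinom (dm : (mdeg m < (mdeg m0).+1)%N)); rewrite ?mem_enum.
have PD i : P`_i \is a mpolyOver n D.
  apply/mpolyOverP => k.
  have [iP|Pi] := ltnP i (size P); last by rewrite nth_default // mcoeff0 rpred0.
  have [kP|/memN_msupp_eq0 ->] := boolP (k \in msupp P`_i); last exact: rpred0.
  apply: sD; rewrite inE mem_cat; apply/orP; right; apply/orP; right.
  apply/flattenP; exists [seq P`_i@_k | k <- msupp P`_i]; last exact: map_f.
  by apply: map_f; rewrite mem_iota.
elim/(@ltmwf n) => m IH.
have [/lowD //|m0m] := leqP (mdeg m) (mdeg m0).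
have m0ltm := lt_mdeg_ltmc m0m.
(* [g] has only earlier coefficients, in [D] by induction, whereas [t] below agrees with [f] up to
   the degree of [m0 + m]. *)
pose g : {mpoly F[n]} :=
  \sum_(k : 'X_{1..n < (mdeg m).+1}) (if (bmnm k < m)%O then f k else 0) *: 'X_[k].
have gD : g \is a mpolyOver n D.
  apply: rpred_sum => k _; apply: mpolyOverZ; last exact: mpolyOverX.
  by case: ifP => [/IH //|_]; apply: rpred0.
pose d := (mdeg m0 + mdeg m)%N; set t := trunc d f.
have tE k : (mdeg k <= d)%N -> t@_k = f k by move=> dk; rewrite -(approx_trunc f dk).
have gE k : (mdeg k <= mdeg m)%N -> g@_k = if (k < m)%O then f k else 0.
  move=> dk.
  by rewrite (@mcoeff_mpoly _ _ (fun k => if (k < m)%O then f k else 0)).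
have gt_ge : supp_ge m (g - t).
  move=> k km; have dk := lemc_mdeg (ltW km).
  by rewrite mcoeffB gE // tE ?km ?subrr // /d; lia.
have gt_m : (g - t)@_m = - f m.
  by rewrite mcoeffB gE // tE ?ltxx ?sub0r // /d; lia.
have dP_ge : supp_ge m0 P^`().[t].
  move=> k km0; have dk := lemc_mdeg (ltW km0).
  rewrite -(approx_eval_poly _ (@approx_trunc _ _ d f)); first exact: Qlo.
  by rewrite /d; lia.
have dP_m0 : P^`().[t]@_m0 = Q m0.
  rewrite -(approx_eval_poly _ (@approx_trunc _ _ d f)) //.
  by rewrite /d; lia.
have [r Tr] := horner_taylor2 P t (g - t).
(* In Taylor's formula at [t], the constant term vanishes up to degree [d], and the quadratic one
   has no monomial before [m + m], which exceeds [m0 + m]. Only the product of the lowest terms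
   remains. *)
have Pg : P.[g]@_(m0 + m)%MM = - (Q m0 * f m).
  rewrite -[g in P.[g]](subrKC t g) Tr !mcoeffD.
  rewrite Pf ?mdegD // mcoeffM_supp_ge // dP_m0 gt_m add0r mulrN.
  have sq_ge : supp_ge (m + m + 0)%MM ((g - t) ^+ 2 * r).
    apply: supp_geM; first by rewrite expr2; apply: supp_geM.
    by move=> k; rewrite ltNge le0m.
  by rewrite sq_ge ?addr0 // addm0 ltmc_add2l.
have -> : f m = - ((Q m0)^-1 * P.[g]@_(m0 + m)%MM).
  by rewrite Pg mulrN mulKf // opprK.
rewrite rpredN rpredM //; apply: (mpolyOverP _).
rewrite horner_coef; apply: rpred_sum => i _; apply: rpredM => //.
exact: rpredX.
Qed.

(** * Hilbert's basis theorem *)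

(** Each [g i] minimizes [u] over a tail of indices that contains [g i.+1]. *)
Lemma nondecreasing_subsequence (u : nat -> nat) :
  exists2 g : nat -> nat, (forall i, g i < g i.+1)%N
    & forall i, (u (g i) <= u (g i.+1))%N.
Proof.
have argmin N : exists a, (N <= a)%N /\ forall b, (N <= b)%N -> (u a <= u b)%N.
  suff bnd k a : (u a <= k)%N -> (N <= a)%N ->
      exists a, (N <= a)%N /\ forall b, (N <= b)%N -> (u a <= u b)%N.
    exact: (bnd (u N) N).
  elim: k a => [|k IH] a uak Na; first by exists a; split=> // b _; lia.
  have [[b [Nb ub]]|none] := classic (exists b, (N <= b)%N /\ (u b < u a)%N).
    by apply: (IH b) => //; lia.
  exists a; split=> // b Nb; rewrite leqNgt; apply/negP => ba.
  by apply: none; exists b.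
pose A N := proj1_sig (constructive_indefinite_description _ (argmin N)).
have AP N : (N <= A N)%N /\ forall b, (N <= b)%N -> (u (A N) <= u b)%N.
  by rewrite /A; case: constructive_indefinite_description.
pose g := fix g i := if i is j.+1 then A (g j).+1 else A 0.
exists g => [i|i] /=; first by case: (AP (g i).+1).
have [Agi _] := AP (g i).+1.
by case: i Agi => [|i] /= Agi; apply: (AP _).2; [| have := (AP (g i).+1).1]; lia.
Qed.

(** Nondecreasing subsequences are extracted one coordinate at a time; the first two terms of the
    last one are comparable. *)
Lemma dickson n (s : nat -> 'X_{1..n}) :
  exists i j, (i < j)%N /\ (s i <= s j)%MM.
Proof.
suff prefix k : (k <= n)%N -> exists2 g : nat -> nat, (forall i, g i < g i.+1)%N
    & forall (c : 'I_n) i, (c < k)%N -> (s (g i) c <= s (g i.+1) c)%N.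
  have [g gi sg] := prefix n (leqnn n).
  by exists (g 0%N), (g 1%N); split=> //; apply/mnm_lepP => c; apply: sg.
elim: k => [|k IH] kn; first by exists id.
have [g gi sg] := IH (ltnW kn).
have [h hi sh] := nondecreasing_subsequence (fun i => s (g i) (Ordinal kn)).
have gmono i j : (i < j)%N -> (g i < g j)%N by apply: (homo_ltn ltn_trans).
exists (fun i => g (h i)) => [i|c i]; first exact: gmono.
rewrite ltnS leq_eqVlt => /orP [/eqP ck|ck].
  by have -> : c = Ordinal kn by apply: val_inj.
pose le_c a b := (s (g a) c <= s (g b) c)%N.
have le_tr : transitive le_c by move=> y x z; apply: leq_trans.
apply: (@homo_leq _ id le_c _ le_tr _ _ _ (ltnW (hi i))) => [x|j]; first exact: leqnn.
exact: sg.
Qed.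

Definition is_ideal (R : comNzRingType) (I : R -> Prop) :=
  I 0 /\ forall a p q, I p -> I q -> I (p + a * q).

(** Generation by [s] is phrased through the ideals [J] containing [s], without linear combinations.
    Dickson's lemma gives an [s] whose leading monomials divide all those of [I]; division by [s]
    then leaves no remainder. *)
Lemma hilbert_basis (F : fieldType) n (I : {mpoly F[n]} -> Prop) :
  is_ideal I ->
  exists s : seq {mpoly F[n]}, (forall q, q \in s -> I q) /\
    forall J, is_ideal J -> (forall q, q \in s -> J q) -> forall p, I p -> J p.
Proof.
move=> [I0 IL].
have [s [sI lead_s]] : exists s : seq {mpoly F[n]}, (forall q, q \in s -> I q) /\
    forall p, I p -> p != 0 -> exists q, [/\ q \in s, q != 0 & (mlead q <= mlead p)%MM].
  apply: NNPP => none.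
  (* The hypothesis on [s] stands under the existential so that the choice function [nx] is defined
     on all lists. *)
  have next (s : seq {mpoly F[n]}) : exists p, (forall q, q \in s -> I q) ->
      [/\ I p, p != 0 & forall q, q \in s -> q != 0 -> ~~ (mlead q <= mlead p)%MM].
    apply: NNPP => nonext; apply: none; exists s; split=> [q qs|p Ip nzp].
      by apply: NNPP => nIq; apply: nonext; exists 0 => sI; case: nIq; apply: sI.
    apply: NNPP => noq; apply: nonext; exists p => sI; split=> // q qs nzq.
    by apply/negP => qp; apply: noq; exists q.
  pose nx s := proj1_sig (constructive_indefinite_description _ (next s)).
  have nxP s : (forall q, q \in s -> I q) ->
      [/\ I (nx s), nx s != 0 &
          forall q, q \in s -> q != 0 -> ~~ (mlead q <= mlead (nx s))%MM].
    by rewrite /nx; case: constructive_indefinite_description.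
  (* For [i < j], [nx (l i)] belongs to [l j], so its leading monomial does not divide that of
     [nx (l j)], against Dickson's lemma. *)
  pose l := fix l k := if k is j.+1 then nx (l j) :: l j else [::].
  have lI k q : q \in l k -> I q.
    elim: k q => //= k IH q; rewrite inE => /orP [/eqP ->|/IH //].
    by case: (nxP _ IH).
  have [i [j [ij]]] := dickson (fun k => mlead (nx (l k))).
  apply/negP; have [_ _ -> //] := nxP _ (@lI j); last by case: (nxP _ (@lI i)).
  elim: j ij => // j IH; rewrite ltnS leq_eqVlt /= inE.
  by case/orP => [/eqP ->|/IH ->]; rewrite ?eqxx ?orbT.
exists s; split=> // J [J0 JL] sJ.
elim/mleadrect => p IH Ip; have [->//|nzp] := eqVneq p 0.
have [q [qs nzq qp]] := lead_s p Ip nzp.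
(* [a * q] has the leading term of [p], so the remainder is zero or has a smaller leading
   monomial. *)
pose a : {mpoly F[n]} := (p@_(mlead p) / q@_(mlead q)) *: 'X_[mlead p - mlead q].
have -> : p = (p - a * q) + a * q by rewrite subrK.
apply: (JL) (sJ _ qs).
have [->//|nzr] := eqVneq (p - a * q) 0.
apply: IH; last by rewrite -mulNr; apply: IL => //; apply: sI.
rewrite lt_neqAle; apply/andP; split.
  apply: contraNneq nzr => lead_r; rewrite -mleadc_eq0 lead_r mcoeffB.
  have Xq : ('X_[mlead p - mlead q] * q)@_(mlead p) = q@_(mlead q).
    by have := mcoeffMX q (mlead p - mlead q) (mlead q); rewrite submK // mulrC.
  by rewrite -scalerAl mcoeffZ Xq divfK ?subrr // mleadc_eq0.
apply: le_trans (mleadB_le _ _) _; rewrite leUx lexx /=.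
rewrite -scalerAl (le_trans (mleadZ_le _ _)) //.
by rewrite mleadM ?mleadXm ?submK // -msupp_eq0 msuppX.
Qed.

(** * Specialization *)

(** The generating property is applied with [J] the ideal of polynomials vanishing at [t]. The
    conclusion says that evaluation at [t] factors through [K[v]]. *)
Lemma pure_specialization (K K' : fieldType) (phi : {rmorphism K -> K'})
    N (v : 'I_N -> K') :
  alg_pure phi ->
  exists t : 'I_N -> K, forall p, (map_mpoly phi p).@[v] = 0 -> p.@[t] = 0.
Proof.
move=> pure.
have [|s [sv s_gen]] := @hilbert_basis K N (fun p => (map_mpoly phi p).@[v] = 0).
  split=> [|a p q pv qv]; first by rewrite !rmorph0.
  by rewrite rmorphD rmorphM /= mevalD mevalM pv qv mulr0 addr0.
have [t ts] := pure N s (ex_intro _ v sv).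
exists t; apply: (s_gen (fun p => p.@[t] = 0)) => //.
split=> [|a p1 p2 h1 h2]; first exact: rmorph0.
by rewrite mevalD mevalM h1 h2 mulr0 addr0.
Qed.

Section Order.
Variables (R : nzRingType) (n : nat) (f : series R n).

Lemma ps_ord_None : (forall m, f m = 0) -> ps_ord f = None.
Proof.
move=> f0; rewrite /ps_ord; case: ClassicalDescription.excluded_middle_informative => // ex.
by exfalso; have [m] := ex; rewrite f0.
Qed.

Lemma ps_ord_Some m0 :
  f m0 != 0 -> (forall m, (mdeg m < mdeg m0)%N -> f m = 0) ->
  ps_ord f = Some (mdeg m0).
Proof.
move=> /eqP fm0 lo; rewrite /ps_ord.
case: ClassicalDescription.excluded_middle_informative => [ex|[]]; last by exists m0.
case: ex_minnP => d fd dmin; congr Some; apply/eqP; rewrite eqn_leq dmin.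
  move: fd; rewrite /Defs.ord_pred;
    case: ClassicalDescription.excluded_middle_informative => // h _.
  by have [m [<- fm]] := h; rewrite leqNgt; apply/negP => /lo.
by rewrite /Defs.ord_pred;
    case: ClassicalDescription.excluded_middle_informative => // -[]; exists m0.
Qed.

End Order.

(** * Lifting along a ring morphism *)

Section Lifting.
Variables (R F : nzRingType) (psi : {rmorphism R -> F}).

Lemma lift_series n (f : series F n) :
  (forall m, exists r, psi r = f m) -> exists g, ps_map psi g = f.
Proof.
move=> im; exists (fun m => proj1_sig (constructive_indefinite_description _ (im m))).
apply: functional_extensionality => m.
by rewrite /ps_map; case: constructive_indefinite_description.
Qed.

Lemma lift_mpoly n (p : {mpoly F[n]}) :
  (forall m, exists r, psi r = p@_m) -> exists q, map_mpoly psi q = p.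
Proof.
move=> /lift_series [g gp]; exists (\sum_(m <- msupp p) g m *: 'X_[m]).
rewrite rmorph_sum [RHS]mpolyE; apply: eq_bigr => m _ /=.
by rewrite map_mpolyZ map_mpolyX -[psi (g m)]/(ps_map psi g m) gp.
Qed.

Lemma lift_poly (P : {poly F}) :
  (forall i, exists r, psi r = P`_i) -> exists Q, map_poly psi Q = P.
Proof.
move=> im; pose g i := proj1_sig (constructive_indefinite_description _ (im i)).
have gP i : psi (g i) = P`_i by rewrite /g; case: constructive_indefinite_description.
exists (\poly_(i < size P) g i); apply/polyP => i; rewrite coef_map coef_poly.
case: ltnP => [_|Pi]; first exact: gP.
by rewrite (nth_default _ Pi); exact: rmorph0.
Qed.

End Lifting.

Section RangePredicate.
Variables (R F : nzRingType) (psi : {rmorphism R -> F}).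

(** A boolean form of the image of [psi], to serve as the subring [D] in [algebraic_coef_fg]. *)
Definition rmorph_range : {pred F} := fun x =>
  if excluded_middle_informative (exists r, psi r = x) then true else false.

Lemma rmorph_rangeP x : reflect (exists r, psi r = x) (x \in rmorph_range).
Proof.
rewrite unfold_in /rmorph_range.
by case: excluded_middle_informative => ?; constructor.
Qed.

Lemma rmorph_range_subring : subring_closed rmorph_range.
Proof.
split=> [|x y /rmorph_rangeP [r <-] /rmorph_rangeP [s <-]
         |x y /rmorph_rangeP [r <-] /rmorph_rangeP [s <-]]; apply/rmorph_rangeP.
- by exists 1; rewrite rmorph1.
- by exists (r - s); rewrite rmorphB.
- by exists (r * s); rewrite rmorphM.
Qed.

HB.instance Definition _ :=
  GRing.isSubringClosed.Build F rmorph_range rmorph_range_subring.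

End RangePredicate.

(* Inverting the lowest coefficient of [f] and one nonzero coefficient of an
   annihilating polynomial makes the order and the algebraicity of [f] survive
   any specialization [tau]. *)
Lemma algebraic_series_specialization (F : fieldType) n (f : series F n) :
  algebraic_series f ->
  exists s : seq F, forall (R : nzRingType) (K : fieldType)
      (psi : {rmorphism R -> F}) (tau : {rmorphism R -> K}),
    (forall x, psi x = 0 -> tau x = 0) ->
    (forall x, x \in s -> exists r, psi r = x) ->
    exists g : series R n, [/\ ps_map psi g = f,
      algebraic_series (ps_map tau g) & ps_ord (ps_map tau g) = ps_ord f].
Proof.
move=> algf; have [s0 s0P] := algebraic_coef_fg algf.
have [P [nzP Pf]] := algf.
pose e := mleadc (lead_coef P).
have nze : e != 0 by rewrite mleadc_eq0 lead_coef_eq0.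
(* [lo] is the lowest coefficient, to be inverted; for [f = 0] it is 0, whose inverse is 0 by
   convention. *)
have [lo loP] : exists lo : F, f = @ps_zero F n \/ exists m0,
    [/\ f m0 != 0, forall m, (mdeg m < mdeg m0)%N -> f m = 0 & lo = f m0].
  have [f0|nzf] := classic (f = @ps_zero F n); first by exists 0; left.
  have [m0 [fm0 below]] := exists_lowest_monomial nzf.
  by exists (f m0); right; exists m0; split=> // m /lt_mdeg_ltmc /below.
exists [:: lo^-1, e^-1 & s0 ++
  flatten [seq [seq P`_i@_k | k <- msupp P`_i] | i <- iota 0 (size P)]].
move=> R K psi tau ker im.
(* [r * r' - 1] lies in the kernel of [psi], hence in that of [tau]. *)
have tau_inv r r' : psi r != 0 -> psi r' = (psi r)^-1 -> tau r != 0.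
  move=> nzr r'E; apply/negP => /eqP tr0.
  have := ker (r * r' - 1); rewrite !rmorphB !rmorphM !rmorph1 r'E mulfV // subrr.
  by move=> /(_ erefl) /eqP; rewrite tr0 mul0r sub0r oppr_eq0 oner_eq0.
have [g gf] : exists g, ps_map psi g = f.
  apply: lift_series => m; apply/rmorph_rangeP.
  apply: (s0P (rmorph_range psi)) => x xs0; apply/rmorph_rangeP; apply: im.
  by rewrite !inE mem_cat xs0 !orbT.
have [Q QP] : exists Q, map_poly (map_mpoly psi) Q = P.
  apply: lift_poly => i; apply: lift_mpoly => k.
  have [iP|Pi] := ltnP i (size P); last first.
    by exists 0; rewrite nth_default // mcoeff0 rmorph0.
  have [kP|/memN_msupp_eq0 ->] := boolP (k \in msupp P`_i); last first.
    by exists 0; rewrite rmorph0.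
  apply: im; rewrite !inE mem_cat; apply/orP; right; apply/orP; right.
  apply/orP; right; apply/flattenP.
  exists [seq P`_i@_k | k <- msupp P`_i]; last exact: map_f.
  by apply: map_f; rewrite mem_iota.
exists g; split=> //.
- exists (map_poly (map_mpoly tau) Q); split.
    have [r' r'E] : exists r', psi r' = e^-1 by apply: im; rewrite !inE eqxx orbT.
    (* [r] lifts [e], whose inverse also lifts; so [tau r] is nonzero and the specialized polynomial
       too. *)
    pose r := Q`_(size P).-1@_(mlead (lead_coef P)).
    have rE : psi r = e by rewrite -mcoeff_map_mpoly -coef_map QP.
    have := @tau_inv r r'; rewrite rE => /(_ nze r'E).
    rewrite -mcoeff_map_mpoly -coef_map; apply: contraNneq => ->.
    by rewrite coef0 mcoeff0.
  rewrite -ps_map_eval_poly; apply: functional_extensionality => m.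
  apply: ker; rewrite -[LHS]/(ps_map psi (ps_eval_poly Q g) m).
  by rewrite ps_map_eval_poly QP gf Pf.
have gE m : psi (g m) = f m by rewrite -gf.
case: loP => [f0|[m0 [fm0 below Elo]]].
  rewrite !ps_ord_None // => m; rewrite ?f0 //.
  by apply: ker; rewrite gE f0.
have [r' r'E] : exists r', psi r' = (f m0)^-1 by apply: im; rewrite Elo inE eqxx.
rewrite !(@ps_ord_Some _ _ _ m0) // => [|m mm0].
  by apply: (@tau_inv _ r'); rewrite gE.
by apply: ker; rewrite gE below.
Qed.

Theorem theorem2p1 (K K' : fieldType) (phi : {rmorphism K -> K'})
  (n p : nat) (J : 'I_p -> {set 'I_n})
  (q : nat) (f : 'I_q -> spoly K n p)
  (yhat : forall i : 'I_p, series K' #|J i|) :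
  alg_pure phi ->
  (forall j, spoly_over_alg (f j)) ->
  (forall i, algebraic_series (yhat i)) ->
  (forall j, spoly_eval (spoly_map phi (f j))
               (fun i => ps_embed (yhat i)) = @ps_zero K' n) ->
  exists y : forall i : 'I_p, series K #|J i|,
    (forall i, algebraic_series (y i)) /\
    (forall j, spoly_eval (f j) (fun i => ps_embed (y i)) = @ps_zero K n) /\
    (forall i, ps_ord (y i) = ps_ord (yhat i)).
Proof.
move=> pure _ alg sol.
pose spec i := constructive_indefinite_description _
  (algebraic_series_specialization (alg i)).
pose L := flatten [seq proj1_sig (spec i) | i : 'I_p].
pose v (k : 'I_(size L)) := L`_k.
have [t ker] := pure_specialization v pure.
(* Polynomials in free variables replace [K[v]]: no quotient is formed, since [ker] puts the kernel
   of [psi] inside that of [tau]. *)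
pose R : comNzRingType := {mpoly K[size L]}.
pose psi : {rmorphism R -> K'} := meval v \o map_mpoly phi.
pose tau : {rmorphism R -> K} := meval t.
have imL x : x \in L -> exists r, psi r = x.
  move=> xL; have xlt : (index x L < size L)%N by rewrite index_mem.
  exists 'X_(Ordinal xlt).
  by rewrite /psi /= map_mpolyX mevalXU /v /= nth_index.
have lift i : exists g : series R #|J i|, [/\ ps_map psi g = yhat i,
    algebraic_series (ps_map tau g) & ps_ord (ps_map tau g) = ps_ord (yhat i)].
  apply: (proj2_sig (spec i)) => // x xs; apply: imL.
  by apply/flattenP; exists (proj1_sig (spec i)) => //; apply: map_f; rewrite mem_enum.
pose g i := proj1_sig (constructive_indefinite_description _ (lift i)).
have gP i : [/\ ps_map psi (g i) = yhat i, algebraic_series (ps_map tau (g i))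
    & ps_ord (ps_map tau (g i)) = ps_ord (yhat i)].
  by rewrite /g; case: constructive_indefinite_description.
exists (fun i => ps_map tau (g i)); split; first by move=> i; case: (gP i).
split; last by move=> i; case: (gP i).
(* [E] is [f j] at the lifts, over [R]. Its image under [psi] is zero by [sol], so [tau] kills all
   its coefficients. *)
move=> j; pose E := spoly_eval (spoly_map (@mpolyC (size L) K) (f j))
  (fun i => ps_embed (g i)).
have map_const (S : nzRingType) (psi' : {rmorphism R -> S}) (th : K -> S) :
    (forall c, psi' c%:MP = th c) ->
    spoly_map psi' (spoly_map (@mpolyC (size L) K) (f j)) = spoly_map th (f j).
  move=> psiC; rewrite /spoly_map -map_comp; apply: eq_map => -[h a] /=.
  by congr (_, _); apply: functional_extensionality => m; apply: psiC.
have psiE : ps_map psi E = @ps_zero K' n.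
  rewrite ps_map_spoly_eval (map_const _ _ phi) => [|c]; last first.
    by rewrite /psi /= map_mpolyC mevalC.
  rewrite -[RHS](sol j); congr spoly_eval; apply: functional_extensionality => i.
  by rewrite ps_map_embed; case: (gP i) => ->.
have tauE : ps_map tau E = spoly_eval (f j) (fun i => ps_embed (ps_map tau (g i))).
  rewrite ps_map_spoly_eval (map_const _ _ id) => [|c]; last exact: mevalC.
  congr spoly_eval.
    by rewrite /spoly_map -[RHS]map_id; apply: eq_map => -[].
  by apply: functional_extensionality => i; rewrite ps_map_embed.
rewrite -tauE; apply: functional_extensionality => m; apply: ker.
exact: (congr1 (fun h : series K' n => h m) psiE).
Qed.
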